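(* Let $G$ be a regular Lie group with Lie algebra $\mathfrak g=\mathbf T_eG$. For all $X,Y\in\mathfrak g$ and all $d_1,d_2\in D$, $$\exp\big((d_1+d_2)X\big).\exp\big((d_1+d_2)Y\big)=\exp\big((d_1+d_2)(X+Y)+d_1d_2[X,Y]\big)=\exp\Big((d_1+d_2)(X+Y)+\frac{(d_1+d_2)^2}{2}[X,Y]\Big).$$
   Context: We work in synthetic differential geometry. $\mathbb R$ is the line: a commutative ring in which positive integers are invertible, satisfying the (general) Kock-Lawvere axiom. $D=\{d\in\mathbb R\mid d^2=0\}$. A space $M$ is microlinear if every finite diagram of infinitesimal spaces that $\mathbb R$ perceives as a colimit is also perceived as a colimit by $M$. A Lie group is a group which is microlinear as a space; its unit is $e$ and its product is written with a dot. $\mathfrak g=\mathbf T_eG$ is the set of maps $X:D\to G$, $d\mapsto X_d$, with $X_0=e$; it is an $\mathbb R$-module with $(\alpha X)_d=X_{\alpha d}$ and $(X+Y)_d=X_d.Y_d=Y_d.X_d$, and a Lie algebra whose bracket $[X,Y]$ is the unique element of $\mathfrak g$ with $X_{d_1}.Y_{d_2}.X_{-d_1}.Y_{-d_2}=[X,Y]_{d_1d_2}$ for all $d_1,d_2\in D$. A Lie group $G$ is regular if for every map $\varsigma:\mathbb R\to\mathfrak g$ there is a map $\theta:\mathbb R\to G$ with $\theta(0)=e$ and $\theta(t+d)=\theta(t).\varsigma(t)_d$ for all $t\in\mathbb R$, $d\in D$. For $X\in\mathfrak g$, if $\theta:\mathbb R\to G$ is a one-parameter subgroup (a homomorphism from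 the additive group of $\mathbb R$) with $\theta(d)=X_d$ for all $d\in D$, then $\exp X$ denotes $\theta(1)$; when $G$ is regular, $\exp:\mathfrak g\to G$ is a total function. *)

(* Defs.v *)
(* Synthetic differential geometry in Rocq's own intuitionistic logic: spaces
   are types and maps are functions.  No library ring hierarchy carrying a
   decidable equality (e.g. MathComp's) can be used for the line: if equality
   on the line were decidable, the Kock-Lawvere axiom would force 0 = 1.  For
   the same reason excluded middle combined with a choice principle is
   incompatible with a nontrivial line. *)
From Stdlib Require Import List Ring_theory.
From Stdlib Require Fin.

Set Implicit Arguments.
Unset Strict Implicit.
Unset Printing Implicit Defensive.

Declare Scope line_scope.
Delimit Scope line_scope with L.
Declare Scope lie_scope.
Delimit Scope lie_scope with G.
Local Open Scope line_scope.

(* [ninv n] is relevant only for [n <> 0], where it is the (necessarily unique)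
   inverse of the integer n. *)
Record qring := QRing {
  line_car :> Type;
  lzero : line_car;
  lone : line_car;
  ladd : line_car -> line_car -> line_car;
  lmul : line_car -> line_car -> line_car;
  lopp : line_car -> line_car;
  ninv : nat -> line_car;
  line_ring : ring_theory lzero lone ladd lmul
                (fun x y => ladd x (lopp y)) lopp eq;
  ninvP : forall n : nat, n <> 0 ->
            lmul (Nat.iter n (ladd lone) lzero) (ninv n) = lone
}.

Arguments lzero {q}.
Arguments lone {q}.
Arguments ninv {q} _.

Notation "0" := lzero : line_scope.
Notation "1" := lone : line_scope.
Notation "x + y" := (ladd x y) : line_scope.
Notation "x * y" := (lmul x y) : line_scope.

Fixpoint lsum (R : qring) (n : nat) : (Fin.t n -> R) -> R :=
  match n with
  | O => fun _ => 0
  | S m => fun f => f Fin.F1 + lsum (fun i => f (Fin.FS i))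
  end.

(* Coordinates of the product of u, v in the R-algebra (without unit) R^n whose
   basis satisfies e_i e_j = sum_k c i j k e_k. *)
Definition vmul (R : qring) (n : nat) (c : Fin.t n -> Fin.t n -> Fin.t n -> R)
    (u v : Fin.t n -> R) : Fin.t n -> R :=
  fun k => lsum (fun i => lsum (fun j => u i * v j * c i j k)).

(* A Weil algebra over R is W = R (+) m, where m is a nilpotent ideal that is
   free of finite rank n as a module; it is given here by the structure
   constants of m in a basis. *)
Record weil (R : qring) := Weil {
  wrank : nat;
  wconst : Fin.t wrank -> Fin.t wrank -> Fin.t wrank -> R;
  wmulC : forall u v k, vmul wconst u v k = vmul wconst v u k;
  wmulA : forall u v w k,
    vmul wconst u (vmul wconst v w) k = vmul wconst (vmul wconst u v) w k;
  wnilpotent : exists N : nat, forall (u : Fin.t wrank -> R) l,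
    length l = N -> forall k, fold_left (vmul wconst) l u k = 0
}.

(* The infinitesimal space Spec_R(W) of R-algebra homomorphisms W -> R: such a
   homomorphism is determined by the images x_i of the basis e_i of m, which
   may be any scalars with x_i x_j = sum_k c i j k x_k. *)
Definition Spec (R : qring) (W : weil R) : Type :=
  {x : Fin.t (wrank W) -> R |
    forall i j, x i * x j = lsum (fun k => wconst i j k * x k)}.

(* The canonical map W -> R^(Spec W), at the element a0 + sum_k a_k e_k. *)
Definition weil_eval (R : qring) (W : weil R) (a0 : R)
    (a : Fin.t (wrank W) -> R) (x : Spec W) : R :=
  a0 + lsum (fun k => a k * proj1_sig x k).

Definition kock_lawvere (R : qring) : Prop :=
  forall (W : weil R) (f : Spec W -> R),
  exists (a0 : R) (a : Fin.t (wrank W) -> R),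
    (forall x, f x = weil_eval a0 a x) /\
    forall (b0 : R) (b : Fin.t (wrank W) -> R),
      (forall x, f x = weil_eval b0 b x) -> b0 = a0 /\ forall k, b k = a k.

(* A diagram of infinitesimal spaces on a finite graph (nv vertices, na
   arrows), together with a cocone on it. *)
Record cocone (R : qring) := Cocone {
  nv : nat;
  na : nat;
  dsrc : Fin.t na -> Fin.t nv;
  dtgt : Fin.t na -> Fin.t nv;
  dobj : Fin.t nv -> weil R;
  darr : forall a, Spec (dobj (dsrc a)) -> Spec (dobj (dtgt a));
  ctip : weil R;
  cleg : forall v, Spec (dobj v) -> Spec ctip;
  cleg_comm : forall a x, cleg (darr (a := a) x) = cleg x
}.

Definition perceives_colimit (R : qring) (K : cocone R) (M : Type) : Prop :=
  forall g : (forall v, Spec (dobj (c := K) v) -> M),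
    (forall a x, g (dtgt a) (darr (a := a) x) = g (dsrc a) x) ->
    exists h : Spec (ctip K) -> M,
      (forall v x, h (cleg (v := v) x) = g v x) /\
      forall h' : Spec (ctip K) -> M,
        (forall v x, h' (cleg (v := v) x) = g v x) -> forall y, h' y = h y.

Definition microlinear (R : qring) (M : Type) : Prop :=
  forall K : cocone R, perceives_colimit K R -> perceives_colimit K M.

Record lie_group (R : qring) := LieGroup {
  gcar :> Type;
  gone : gcar;
  gmul : gcar -> gcar -> gcar;
  ginv : gcar -> gcar;
  gmulA : forall x y z, gmul x (gmul y z) = gmul (gmul x y) z;
  gmul1l : forall x, gmul gone x = x;
  gmul1r : forall x, gmul x gone = x;
  gmulVl : forall x, gmul (ginv x) x = gone;
  gmulVr : forall x, gmul x (ginv x) = gone;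
  gmicrolinear : microlinear R gcar
}.

Arguments gone {R l}.

Notation "x ⋅ y" := (gmul x y) (at level 40, left associativity) : lie_scope.
Local Open Scope lie_scope.

Definition D (R : qring) : Type := {d : R | d * d = 0}.
Definition Dval (R : qring) (d : D R) : R := proj1_sig d.
Coercion Dval : D >-> line_car.

Lemma Dscale_subproof (R : qring) (a : R) (d : D R) :
  a * d * (a * d) = 0.
Proof.
pose proof (line_ring R) as H; destruct d as [d Hd]; simpl.
rewrite (Rmul_comm H a d), (Rmul_assoc H (d * a) d a).
rewrite (Rmul_comm H d a), <- (Rmul_assoc H a d d), Hd.
rewrite (Rmul_comm H a lzero).
now rewrite !(Rmul_0_l (Eqsth R) (Eq_ext _ _ _) H).
Qed.

(* For d1, d2 in D, [Dscale d1 d2] is their product in D. *)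
Definition Dscale (R : qring) (a : R) (d : D R) : D R :=
  exist _ (a * d) (Dscale_subproof a d).

Definition Dopp (R : qring) (d : D R) : D R := Dscale (lopp 1) d.

(* T_e G.  The condition X_0 = e is imposed at every element of D with value 0,
   so that the operations below need no proof irrelevance. *)
Record lie_algebra (R : qring) (G : lie_group R) := Tangent {
  tmap :> D R -> G;
  tmap0 : forall d : D R, Dval d = 0 -> tmap d = gone
}.

Lemma tscale_subproof (R : qring) (G : lie_group R) (a : R)
  (X : lie_algebra G) (d : D R) : Dval d = 0 -> X (Dscale a d) = gone.
Proof.
intro Hd; apply tmap0; simpl; rewrite Hd.
pose proof (line_ring R) as H.
rewrite (Rmul_comm H a lzero).
exact (Rmul_0_l (Eqsth R) (Eq_ext _ _ _) H a).
Qed.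

Lemma tadd_subproof (R : qring) (G : lie_group R) (X Y : lie_algebra G)
  (d : D R) : Dval d = 0 -> X d ⋅ Y d = gone.
Proof. now intro Hd; rewrite !tmap0, gmul1l. Qed.

Definition tscale (R : qring) (G : lie_group R) (a : R) (X : lie_algebra G) :
  lie_algebra G := Tangent (@tscale_subproof R G a X).

Definition tadd (R : qring) (G : lie_group R) (X Y : lie_algebra G) :
  lie_algebra G := Tangent (@tadd_subproof R G X Y).

Notation "a *: X" := (tscale a%L X) (at level 40) : lie_scope.
Notation "X + Y" := (tadd X Y) : lie_scope.

(* [br] is the bracket of T_e G.  Microlinearity of G makes the element
   [br X Y] exist and be unique; it is specified rather than constructed
   because passing from unique existence to a function is an axiom in Rocq. *)
Definition is_lie_bracket (R : qring) (G : lie_group R)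
    (br : lie_algebra G -> lie_algebra G -> lie_algebra G) : Prop :=
  forall (X Y : lie_algebra G) (d1 d2 : D R),
    X d1 ⋅ Y d2 ⋅ X (Dopp d1) ⋅ Y (Dopp d2) = br X Y (Dscale d1 d2).

Definition regular (R : qring) (G : lie_group R) : Prop :=
  forall s : R -> lie_algebra G, exists theta : R -> G,
    theta 0 = gone /\
    forall (t : R) (d : D R), theta (t + d)%L = theta t ⋅ s t d.

Definition one_parameter_subgroup (R : qring) (G : lie_group R)
    (theta : R -> G) : Prop :=
  forall s t : R, theta (s + t)%L = theta s ⋅ theta t.

(* exp X is theta(1) for every one-parameter subgroup theta with velocity X:
   that this is independent of theta is part of exp being a function. *)
Definition is_exponential (R : qring) (G : lie_group R)
    (exp : lie_algebra G -> G) : Prop :=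
  forall (X : lie_algebra G) (theta : R -> G),
    one_parameter_subgroup theta -> (forall d : D R, theta d = X d) ->
    exp X = theta 1.

(* Main.v *)
Require Import Defs.
From Stdlib Require Import Ring.
Local Open Scope lie_scope.

(** Only infinitesimal multiples of tangent vectors are exponentiated, so the
    one-parameter subgroups can be written down explicitly.  Restricted to sums
    of elements of D, the solution theta of theta(t+d) = theta(t).X_d supplied
    by regularity is a homomorphism with theta(d1+d2) = X_d1.X_d2, and hence
    t |-> theta(t(d1+d2)) is a one-parameter subgroup with velocity (d1+d2)X.
    With S = X + Y and B = [X,Y], the map t |-> theta_S(t(d1+d2)).B_(t d1 d2) is
    one too, because [S,B] is evaluated at multiples of d_i d1 d2 = 0.  It
    remains to compare X_d1.X_d2.Y_d1.Y_d2 with X_d1.Y_d1.X_d2.Y_d2.B_(d1 d2),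
    i.e. to move X_d2 across Y_d1. *)

Section RegularLieGroup.

Context {R : qring} {G : lie_group R}.
Context (hG : regular G).

Add Ring line_ring_inst : (line_ring R).

Lemma D_sqr (d : D R) : (d * d)%L = lzero.
Proof. exact (proj2_sig d). Qed.

Lemma mulD_mul0 (a b c : D R) : Dval c = (a * b)%L ->
  (a * c)%L = lzero /\ (b * c)%L = lzero.
Proof.
intro H; rewrite H; split.
- transitivity (a * a * b)%L; [ring|rewrite D_sqr; ring].
- transitivity (b * b * a)%L; [ring|rewrite D_sqr; ring].
Qed.

(** As d1 and d2 square to zero, only the cross term 2 d1 d2 survives. *)
Lemma half_square (d1 d2 : D R) :
  ((d1 + d2) * (d1 + d2) * ninv 2)%L = (d1 * d2)%L.
Proof.
transitivity ((d1 * d1 + d2 * d2) * ninv 2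
              + d1 * d2 * ((1 + (1 + 0)) * ninv 2))%L; [ring|].
change (1 + (1 + 0))%L with (Nat.iter 2 (ladd lone) (@lzero R)).
rewrite ninvP by discriminate.
rewrite !D_sqr.
ring.
Qed.

(** Makes a pointwise product of three homomorphisms multiplicative. *)
Lemma gmulACA3 (a b c a' b' c' : G) :
  b ⋅ a' = a' ⋅ b -> a' ⋅ c = c ⋅ a' -> b' ⋅ c = c ⋅ b' ->
  a ⋅ a' ⋅ (b ⋅ b') ⋅ (c ⋅ c') = a ⋅ b ⋅ c ⋅ (a' ⋅ b' ⋅ c').
Proof.
intros Hba Hac Hbc; rewrite !gmulA.
rewrite <- (gmulA (a ⋅ b) c a'), <- Hac, gmulA.
rewrite <- (gmulA _ c b'), <- Hbc, gmulA.
rewrite <- (gmulA a b a'), Hba, gmulA; reflexivity.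
Qed.

Lemma tangent_flow (X : lie_algebra G) : exists theta : R -> G,
  (forall d : D R, theta d = X d) /\
  (forall (t : R) (d : D R), theta (t + d)%L = theta t ⋅ theta d).
Proof.
destruct (hG (fun _ => X)) as [theta [h0 h]].
assert (hD : forall d : D R, theta d = X d).
{ intro d; rewrite <- (gmul1l (X d)), <- h0, <- h; f_equal; ring. }
exists theta; split; [exact hD|].
intros t d; rewrite hD; apply h.
Qed.

(** Elements of [D] carry a proof, but the flow of X sees only their value. *)
Lemma tangent_ext (X : lie_algebra G) (a b : D R) :
  Dval a = Dval b -> X a = X b.
Proof.
intro H; destruct (tangent_flow X) as [theta [hD _]].
rewrite <- !hD, H; reflexivity.
Qed.

Lemma tangentD (X : lie_algebra G) (a b c : D R) :
  Dval c = (a + b)%L -> X c = X a ⋅ X b.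
Proof.
intro H; destruct (tangent_flow X) as [theta [hD h]].
rewrite <- !hD, H; apply h.
Qed.

(** The flow is defined at a + b even when a + b is not in [D], and there the order of the summands
    is irrelevant. *)
Lemma tangent_comm (X : lie_algebra G) (a b : D R) : X a ⋅ X b = X b ⋅ X a.
Proof.
destruct (tangent_flow X) as [theta [hD h]].
rewrite <- !hD, <- !h; f_equal; ring.
Qed.

Lemma tangentVl (X : lie_algebra G) (a : D R) : X (Dopp a) ⋅ X a = gone.
Proof.
rewrite <- (tangentD X (Dopp a) a (Dscale lzero a)).
- apply tmap0; simpl; ring.
- simpl; ring.
Qed.

Section Bracket.

Context (br : lie_algebra G -> lie_algebra G -> lie_algebra G).
Context (hbr : is_lie_bracket br).

Lemma tangent_swap (X Y : lie_algebra G) (a b : D R) :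
  X a ⋅ Y b = br X Y (Dscale a b) ⋅ Y b ⋅ X a.
Proof.
rewrite <- hbr, <- (gmulA _ (Y (Dopp b))), tangentVl, gmul1r.
rewrite <- (gmulA _ (X (Dopp a))), tangentVl, gmul1r; reflexivity.
Qed.

Lemma tangent_comm_mul0 (X Y : lie_algebra G) (a b : D R) :
  (a * b)%L = lzero -> X a ⋅ Y b = Y b ⋅ X a.
Proof.
intro H; rewrite tangent_swap, (tmap0 (br X Y)), gmul1l; [reflexivity|exact H].
Qed.

Context (exp : lie_algebra G -> G) (hexp : is_exponential exp).

(* [Z] stands for (d1 + d2)S + eB; it is specified by its values so that the
   case without the term eB is covered by e = 0. *)
Lemma exp_infinitesimal (S B Z : lie_algebra G) (d1 d2 e : D R) :
  (d1 * e)%L = lzero -> (d2 * e)%L = lzero ->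
  (forall d, Z d = S (Dscale (d1 + d2)%L d) ⋅ B (Dscale e d)) ->
  exp Z = S d1 ⋅ S d2 ⋅ B e.
Proof.
intros H1 H2 HZ.
assert (comm0 : forall (s t : R) (d : D R), (d * e)%L = lzero ->
    S (Dscale t d) ⋅ B (Dscale s e) = B (Dscale s e) ⋅ S (Dscale t d)).
{ intros s t d H; apply tangent_comm_mul0; simpl.
  transitivity (s * t * (d * e))%L; [ring|rewrite H; ring]. }
(* The flow of S at t(d1 + d2) is written as a product of values at points of [D]. *)
rewrite (@hexp Z (fun t => S (Dscale t d1) ⋅ S (Dscale t d2) ⋅ B (Dscale t e))).
- rewrite (tangent_ext S (Dscale lone d1) d1), (tangent_ext S (Dscale lone d2) d2),
    (tangent_ext B (Dscale lone e) e); [reflexivity|simpl; ring..].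
- intros s t.
  rewrite (tangentD S (Dscale s d1) (Dscale t d1) (Dscale (s + t)%L d1)),
    (tangentD S (Dscale s d2) (Dscale t d2) (Dscale (s + t)%L d2)),
    (tangentD B (Dscale s e) (Dscale t e) (Dscale (s + t)%L e)) by (simpl; ring).
  apply gmulACA3; [apply tangent_comm|apply comm0..]; assumption.
- intro d; rewrite HZ.
  (* The multiple d(d1 + d2) is in [D] although d1 + d2 need not be, so S is additive here. *)
  rewrite (tangentD S (Dscale d d1) (Dscale d d2) (Dscale (d1 + d2)%L d)) by (simpl; ring).
  rewrite (tangent_ext B (Dscale e d) (Dscale d e)) by (simpl; ring).
  reflexivity.
Qed.

Lemma exp_scale (X : lie_algebra G) (d1 d2 : D R) :
  exp ((d1 + d2) *: X) = X d1 ⋅ X d2.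
Proof.
(* Here e has value 0, so the factor from B := X is the unit. *)
rewrite (exp_infinitesimal X X _ d1 d2 (Dscale lzero d1)).
- rewrite (tmap0 (d := Dscale lzero d1) X), gmul1r; [reflexivity|simpl; ring].
- simpl; ring.
- simpl; ring.
- intro d; rewrite (tmap0 (d := Dscale (Dscale lzero d1) d) X), gmul1r by (simpl; ring).
  reflexivity.
Qed.

Lemma exp_scale_mul (X Y : lie_algebra G) (d1 d2 : D R) :
  exp ((d1 + d2) *: X) ⋅ exp ((d1 + d2) *: Y)
    = exp ((d1 + d2) *: (X + Y) + (d1 * d2) *: br X Y).
Proof.
destruct (mulD_mul0 d1 d2 (Dscale d1 d2) eq_refl) as [H1 H2].
rewrite !exp_scale.
rewrite (exp_infinitesimal (X + Y) (br X Y) _ d1 d2 (Dscale d1 d2));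
  [|exact H1|exact H2|reflexivity].
(* The bracket factor sits at d1 d2, which d1 and d2 annihilate, so it commutes with Y_d1 and X_d2
   and can be moved to the right. *)
assert (swap : X d2 ⋅ Y d1 = Y d1 ⋅ X d2 ⋅ br X Y (Dscale d1 d2)).
{ rewrite tangent_swap.
  rewrite (tangent_ext (br X Y) (Dscale d2 d1) (Dscale d1 d2)) by (simpl; ring).
  rewrite <- (tangent_comm_mul0 Y _ d1) by exact H1.
  rewrite <- !gmulA, (tangent_comm_mul0 X _ d2) by exact H2.
  reflexivity. }
cbn [tmap tadd].
rewrite !gmulA, <- (gmulA (X d1) (X d2)), swap, !gmulA.
(* For the same reason it passes Y_d2. *)
rewrite <- !(gmulA _ _ (Y d2)), <- (tangent_comm_mul0 Y _ d2) by exact H2.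
rewrite !gmulA; reflexivity.
Qed.

End Bracket.
End RegularLieGroup.

Theorem theorem39 (R : qring) (hKL : kock_lawvere R)
  (G : lie_group R) (hG : regular G)
  (br : lie_algebra G -> lie_algebra G -> lie_algebra G)
  (hbr : is_lie_bracket br)
  (exp : lie_algebra G -> G) (hexp : is_exponential exp)
  (X Y : lie_algebra G) (d1 d2 : D R) :
  exp ((d1 + d2) *: X) ⋅ exp ((d1 + d2) *: Y)
    = exp ((d1 + d2) *: (X + Y) + (d1 * d2) *: br X Y)
  /\
  exp ((d1 + d2) *: (X + Y) + (d1 * d2) *: br X Y)
    = exp ((d1 + d2) *: (X + Y)
           + ((d1 + d2) * (d1 + d2) * ninv 2) *: br X Y).
Proof.
split; [exact (exp_scale_mul hG br hbr exp hexp X Y d1 d2)|].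
rewrite half_square; reflexivity.
Qed.
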